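(* Let $E$ be a Euclidean Jordan algebra of rank at least $5$. Then the completely positive cone $\mathcal{CP}(E_+)$ over the cone of squares $E_+$ of $E$ is not facially exposed.
   Context: Euclidean Jordan algebra (EJA): a finite-dimensional real vector space $E$ with a commutative bilinear product $\circ$ satisfying $x\circ((x\circ x)\circ y)=(x\circ x)\circ(x\circ y)$ for all $x,y$, with a unit element, and admitting an inner product $\bullet$ with $(x\circ y)\bullet z=x\bullet(y\circ z)$ for all $x,y,z$ (an associative inner product; fix any one). A Jordan frame is a set $\{c_1,\dots,c_r\}$ of nonzero idempotents, none of which is a sum of two nonzero idempotents, with $c_i\circ c_j=0$ for $i\ne j$ and $c_1+\dots+c_r$ equal to the unit; its cardinality $r$ does not depend on the frame and is the rank of $E$. $E_+=\{x\circ x\mid x\in E\}$ is the associated symmetric cone. For a closed cone $K$ in a finite-dimensional real inner product space $V$ (a cone is a set closed under multiplication by all reals $a\ge 0$), $\mathcal{CP}(K)=\{\sum_{i=1}^k a_i\otimes a_i\mid k\ge1,\ a_i\in K\}$, where $x\otimes x$ is the self-adjoint linear map $y\mapsto (x\bullet y)x$ on $V$. It lies in the space $\mathcal{S}(V)$ of self-adjoint linear transformations on $V$, with the induced inner product. A face of a closed convex cone $C$ is a nonempty convex subcone $F\subseteq C$ such that $a,b\in C$ and $a+b\in F$ imply $a,b\in F$. An exposed face is a set $C\cap\{d\}^\perp$ with $d$ in the dual cone $C^*=\{y\mid \langle x,y\rangle\ge0\ \forall x\in C\}$. $C$ is facially exposed if all its faces are exposed. (Facial exposedness of $\mathcal{CP}(E_+)$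 does not depend on the chosen associative inner product.) *)

(* Defs.v *)
From HB Require Import structures.
From mathcomp Require Import all_boot all_order all_algebra sesquilinear.
From mathcomp Require Import boolp classical_sets reals convex.

Set Implicit Arguments.
Unset Strict Implicit.
Unset Printing Implicit Defensive.

Import Order.TTheory GRing.Theory Num.Theory.

Local Open Scope classical_set_scope.
Local Open Scope ring_scope.

(** * Cones and faces *)

Section Cones.
Context {R : realType} {W : lmodType R}.
Implicit Types C F : set W.

Definition cone C := forall (a : R) x, 0 <= a -> C x -> C (a *: x).

Definition face C F :=
  [/\ F !=set0, cone F, convex_set F, F `<=` C &
      forall a b, C a -> C b -> F (a + b) -> F a /\ F b].

(* The ambient inner product space is the subspace [S] of [W], with inner
   product [ip]; nothing is required of [ip] outside [S]. *)
Definition dual_cone (S : set W) (ip : W -> W -> R) C : set W :=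
  [set y | S y /\ forall x, C x -> 0 <= ip x y].

Definition exposed_face (S : set W) (ip : W -> W -> R) C F :=
  exists2 d, dual_cone S ip C d & F = C `&` [set x | ip x d = 0].

Definition facially_exposed (S : set W) (ip : W -> W -> R) C :=
  forall F, face C F -> exposed_face S ip C F.

End Cones.

(** * The completely positive cone *)

Section CompletelyPositive.
Context {R : realType} {V : vectType R}.
Variable ip : {dot V for idfun}.

Definition tens (x : V) : 'End(V) := linfun (fun y => ip x y *: x).

(* [linfun] is only meaningful on linear functions, which this one is. *)
Lemma tensE x y : tens x y = ip x y *: x.
Proof.
have lin : linear (fun y => ip x y *: x).
  by move=> a u v /=; rewrite linearPr scalerDl scalerA.
pose f : {linear V -> V} :=
  HB.pack (fun y => ip x y *: x) (GRing.isLinear.Build R V V *:%R _ lin).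
by rewrite /tens -[fun _ => _]/(f : V -> V) lfunE.
Qed.

Definition selfadjoint : set 'End(V) :=
  [set A | forall x y, ip (A x) y = ip x (A y)].

(* The trace does not depend on the basis. *)
Definition lftrace (A : 'End(V)) : R :=
  \tr (passmx.mxof (vbasis {:V}) (vbasis {:V}) A).

(* For self-adjoint maps this is the inner product induced by [ip]. *)
Definition trace_ip (A B : 'End(V)) : R := lftrace (A \o B)%VF.

Definition CP (K : set V) : set 'End(V) :=
  [set A | exists (k : nat) (a : 'I_k -> V),
    [/\ (1 <= k)%N, forall i, K (a i) & A = \sum_(i < k) tens (a i)]].

End CompletelyPositive.

(** * Euclidean Jordan algebras *)

Definition associative_ip (R : realType) (V : vectType R)
    (mul : V -> V -> V) (ip : V -> V -> R) :=
  forall x y z, ip (mul x y) z = ip x (mul y z).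

Record euclideanJordanAlgebra (R : realType) := EuclideanJordanAlgebra {
  eja_sort :> vectType R;
  jmul : {bilinear eja_sort -> eja_sort -> eja_sort};
  jone : eja_sort;
  jmulC : commutative jmul;
  jordan_identity : forall x y,
    jmul x (jmul (jmul x x) y) = jmul (jmul x x) (jmul x y);
  jmul1x : left_id jone jmul;
  jmul_associative_ip : exists ip : {dot eja_sort for idfun},
    associative_ip jmul ip
}.

Section JordanFrames.
Context {R : realType}.
Variable E : euclideanJordanAlgebra R.

Definition idempotent_elt (c : E) := jmul E c c = c.

Definition primitive_idempotent (c : E) :=
  [/\ c != 0, idempotent_elt c &
      ~ exists a b : E, [/\ a != 0, b != 0, idempotent_elt a,
                            idempotent_elt b & c = a + b]].

(* A frame is given by an indexing of its [r] elements. The indexing is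
   injective: c i = c j with i != j would give c i = jmul (c i) (c j) = 0. *)
Definition jordan_frame (r : nat) (c : 'I_r -> E) :=
  [/\ forall i, primitive_idempotent (c i),
      forall i j, i != j -> jmul E (c i) (c j) = 0 &
      \sum_(i < r) c i = jone E].

(* All Jordan frames have the same cardinality, so [xget] has no choice; the
   default value 0 is never used, as every such algebra has a frame. *)
Definition jordan_rank : nat :=
  xget 0%N [set r | exists c : 'I_r -> E, jordan_frame c].

Definition cone_of_squares : set E := [set y | exists x, y = jmul E x x].

End JordanFrames.

Arguments cone_of_squares {R} E _.

(* Main.v *)
Require Import Defs.
From HB Require Import structures.
From mathcomp Require Import all_boot all_order all_algebra sesquilinear.
From mathcomp Require Import boolp classical_sets reals.
From mathcomp Require Import interval_inference convex ring lra.

Set Implicit Arguments.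
Unset Strict Implicit.
Unset Printing Implicit Defensive.

Import Order.TTheory GRing.Theory Num.Theory.

Local Open Scope classical_set_scope.
Local Open Scope ring_scope.

(** A convex cone fails to be facially exposed as soon as it contains
    elements [a] and [b] such that every dual functional vanishing at [a]
    vanishes at [b], although no [a - t *: b] with [t > 0] stays in the cone:
    the first condition puts [b] in every exposed face through [a], the second
    keeps it out of the minimal face of [a] ([facially_exposed_sub]).

    Fix five members [e 0, ..., e 4] of a Jordan frame, indexed cyclically. The
    elements [a] and [b] come from the Horn form
      [H x = \sum_i x_i ^ 2 - 2 \sum_i x_i x_(i+1) + 2 \sum_i x_i x_(i+2)],
    which is copositive and vanishes on the nonnegative orthant exactly at the
    cyclic shifts of [(p, p + q, q, 0, 0)]. Take [a] to be the sum of [tens u]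
    over the five elements [u = e i + 2 e (i+1) + e (i+2)], and
    [b = tens v] with [v = e 0 + e 1].

    Let [d] be copositive on the cone of squares with [<a, d> = 0]. All
    nonnegative combinations of the [e i] are squares, so the matrix of [d] on
    the [e i] is a copositive 5 by 5 matrix with the five zeros [u]. At such a
    zero the gradient vanishes along the support; these linear equations leave
    only the multiples of the Horn matrix ([horn_rigid] extracts the consequence
    needed), so [<b, d> = 0] since [H v = 0].

    To see that [a - t *: b] is not completely positive for [t > 0], evaluate
    a second form, [G x = \sum_i x_i x_(i+1) - 4 \sum_i x_i x_(i+2)], which
    equals [(p - q) ^ 2] at [(p, p + q, q, 0, 0)]. If [a - t *: b] were a sum of
    [tens x] with [x] in the cone of squares, the coordinates of each [x] along
    the [e i] would be nonnegative, because multiplication by an idempotent is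
    positive semidefinite ([idempotent_dot_ge0], from the Peirce identity
    [2 L^3 - 3 L^2 + L = 0]). As [H] vanishes at all [u] and at [v], it
    vanishes at each [x] ([H >= 0] on nonnegative vectors), hence [G >= 0] at
    each [x] ([horn_imbalance_ge0]). But [G] is [0] at all [u] and [1] at [v],
    so the sum of the values of [G] is [- t < 0]. *)

(** * Minimal faces and exposed faces *)

Section MinimalFace.
Context {R : realType} {W : lmodType R}.
Implicit Types C : set W.

Definition minimal_face C (a : W) : set W :=
  [set x | C x /\ exists2 t : R, 0 < t & C (a - t *: x)].

(** A witness for [x + y] is the harmonic combination of the two witnesses:
    with [t] for [x] and [s] for [y], the weighted mean of [a - t *: x] and
    [a - s *: y] with weights [s / (t + s)] and [t / (t + s)] has equal
    coefficients on [x] and [y]. *)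
Lemma minimal_face_add C a : cone C -> (forall x y, C x -> C y -> C (x + y)) ->
  forall x y, minimal_face C a x -> minimal_face C a y ->
  minimal_face C a (x + y).
Proof.
move=> coneC addC x y [Cx [t t0 Ct]] [Cy [s s0 Cs]].
split; first exact: addC.
have ts0 : 0 < t + s by rewrite addr_gt0.
exists (t * s / (t + s)); first by rewrite divr_gt0 ?mulr_gt0.
have -> : a - (t * s / (t + s)) *: (x + y) =
    (t + s)^-1 *: (s *: (a - t *: x) + t *: (a - s *: y)).
  rewrite !scalerBr !scalerA [s * t]mulrC addrACA -opprD -scalerDl -scalerDr.
  rewrite scalerBr !scalerA [s + t]addrC mulVf ?gt_eqF// scale1r.
  by rewrite [_^-1 * _]mulrC.
apply: (coneC); first by rewrite invr_ge0 ltW.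
by apply: (addC); apply: (coneC) => //; exact: ltW.
Qed.

Lemma minimal_face_cone C a : cone C -> C a -> cone (minimal_face C a).
Proof.
move=> coneC Ca r x r0 [Cx [t t0 Ct]]; split; first exact: coneC.
have [->|rn0] := eqVneq r 0.
  by exists 1 => //; rewrite scale0r scaler0 subr0.
have {rn0}r0 : 0 < r by rewrite lt_def rn0.
exists (t / r); first by rewrite divr_gt0.
by rewrite scalerA mulfVK ?gt_eqF.
Qed.

Lemma minimal_face_face C a : cone C ->
  (forall x y, C x -> C y -> C (x + y)) -> C a -> face C (minimal_face C a).
Proof.
move=> coneC addC Ca; have fcone := minimal_face_cone coneC Ca.
split=> //.
- exists a; split=> //; exists 1 => //.
  by rewrite scale1r subrr -(scale0r a); apply: (coneC).
- move=> x y l; rewrite !inE => Fx Fy.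
  apply: minimal_face_add => //; apply: (fcone) => //.
  by rewrite subr_ge0.
- by move=> x [].
- move=> x y Cx Cy [_ [t t0 Ct]]; split; split=> //; exists t => //.
  + have -> : a - t *: x = a - t *: (x + y) + t *: y.
      by rewrite scalerDr opprD addrA subrK.
    by apply: (addC) => //; apply: (coneC) => //; exact: ltW.
  + have -> : a - t *: y = a - t *: (x + y) + t *: x.
      by rewrite scalerDr opprD addrA addrAC subrK.
    by apply: (addC) => //; apply: (coneC) => //; exact: ltW.
Qed.

(** The minimal face of [a] must be cut out by one dual functional; it vanishes
    at [a], hence at [b], so [b] belongs to that face. *)
Lemma facially_exposed_sub S ip C (a b : W) : cone C ->
  (forall x y, C x -> C y -> C (x + y)) -> facially_exposed S ip C ->
  C a -> C b ->
  (forall d, dual_cone S ip C d -> ip a d = 0 -> ip b d = 0) ->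
  exists2 t : R, 0 < t & C (a - t *: b).
Proof.
move=> coneC addC expC Ca Cb ab.
have [d dd Fd] := expC _ (minimal_face_face coneC addC Ca).
have [_ ad] : (C `&` [set x | ip x d = 0]) a.
  rewrite -Fd; split=> //; exists 1 => //.
  by rewrite scale1r subrr -(scale0r a); apply: (coneC).
have : (C `&` [set x | ip x d = 0]) b by split=> //=; exact: ab.
by rewrite -Fd => -[].
Qed.

End MinimalFace.

(** * Completely positive cones and copositive forms *)

Section CPCone.
Import passmx.
Context {R : realType} {V : vectType R}.
Variable ip : {dot V for idfun}.
Implicit Types (K : set V) (x y z : V).

Lemma dotC x y : ip x y = ip y x.
Proof. by rewrite hermC expr0 mul1r. Qed.

Lemma dot_ge0 x : 0 <= ip x x.
Proof.
by have [->|/neq0_dnorm_gt0/ltW//] := eqVneq x 0; rewrite linear0l.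
Qed.

Lemma dotZl a x y : ip (a *: x) y = a * ip x y.
Proof. exact: linearZl_LR. Qed.

Lemma dotZr a x y : ip x (a *: y) = a * ip x y.
Proof. by rewrite dotC dotZl dotC. Qed.

Lemma dotDl x y z : ip (x + y) z = ip x z + ip y z.
Proof. exact: linearDl. Qed.

Lemma dotDr x y z : ip x (y + z) = ip x y + ip x z.
Proof. exact: linearDr. Qed.

Lemma dot_suml (I : finType) (f : I -> V) y :
  ip (\sum_i f i) y = \sum_i ip (f i) y.
Proof. exact: linear_sumlz. Qed.

Lemma tensZ (a : R) x : tens ip (a *: x) = a ^+ 2 *: tens ip x.
Proof.
apply/lfunP => y; rewrite scale_lfunE !tensE dotZl !scalerA.
by congr (_ *: _); ring.
Qed.

Lemma trace_ip_tens x (d : 'End(V)) : trace_ip (tens ip x) d = ip x (d x).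
Proof.
rewrite /trace_ip /lftrace.
set e := vbasis {:V}.
have be : basis_of {:V} e := vbasisP _.
rewrite {3}[x](coord_basis be) ?memvf// linear_sum linear_sumr.
apply: eq_bigr => i _.
rewrite /mxof mxE /= vecof_delta comp_lfunE tensE.
by rewrite -coord_rVof !linearZ /= mulrC.
Qed.

Lemma trace_ip_sum (I : finType) (X : I -> 'End(V)) d :
  trace_ip (\sum_i X i) d = \sum_i trace_ip (X i) d.
Proof.
apply: (big_morph (fun X => trace_ip X d)) => [Y Z|].
  by rewrite /trace_ip /lftrace comp_lfunDl !linearD.
by rewrite /trace_ip /lftrace comp_lfun0l !linear0.
Qed.

Lemma CP_tens K x : K x -> CP ip K (tens ip x).
Proof. by move=> Kx; exists 1%N, (fun=> x); rewrite big_ord1. Qed.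

Lemma CP_add K (A B : 'End(V)) : CP ip K A -> CP ip K B -> CP ip K (A + B).
Proof.
move=> [k [a [k1 aK ->]]] [l [b [_ bK ->]]].
exists (k + l)%N.
exists (fun i => match split i with inl i => a i | inr i => b i end).
split; first by rewrite ltn_addr.
  by move=> i; case: split.
rewrite big_split_ord /=; congr (_ + _); apply: eq_bigr => i _.
  by rewrite -[lshift _ _]/(unsplit (inl i)) unsplitK.
by rewrite -[rshift _ _]/(unsplit (inr i)) unsplitK.
Qed.

Lemma CP_cone K : cone K -> cone (CP ip K).
Proof.
move=> coneK r _ r0 [k [a [k1 aK ->]]].
exists k, (fun i => Num.sqrt r *: a i); split=> //.
  by move=> i; apply: coneK; rewrite ?sqrtr_ge0.
by rewrite scaler_sumr; apply: eq_bigr => i _; rewrite tensZ sqr_sqrtr.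
Qed.

(** First-order condition at a zero [u] of a copositive form: in a direction
    [v] that can be followed both ways inside [K], the derivative vanishes. *)
Lemma copositive_zero K (d : 'End(V)) u v :
  selfadjoint ip d -> (forall x, K x -> 0 <= ip x (d x)) ->
  ip u (d u) = 0 -> (forall s, `|s| <= 1 -> K (u + s *: v)) ->
  ip v (d u) = 0.
Proof.
move=> sd cd u0 uv.
set g := ip v (d u); set h := ip v (d v).
have pos s : `|s| <= 1 -> 0 <= 2 * s * g + s ^+ 2 * h.
  move=> /uv /cd; rewrite linearD linearZ /= !(dotDl, dotDr).
  rewrite !(dotZl, dotZr) u0 -[ip u (d v)]sd [ip (d u) v]dotC -/g -/h.
  by congr (0 <= _); ring.
have [//|gn0] := eqVneq g 0.
set m := 1 + `|g| + `|h|.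
have m0 : 0 < m by rewrite /m; have := normr_ge0 g; have := normr_ge0 h; lra.
have gm : `|g| <= m by rewrite /m; have := normr_ge0 h; lra.
have hm : h < 2 * m.
  rewrite /m; have := ler_norm h; have := normr_ge0 g; have := normr_ge0 h; lra.
(* This step is short enough for the linear term to beat [s ^+ 2 * h]. *)
have /pos : `|- g / m| <= 1.
  by rewrite normrM normrN normfV (gtr0_norm m0) ler_pdivrMr ?mul1r.
have -> : 2 * (- g / m) * g + (- g / m) ^+ 2 * h = (g / m) ^+ 2 * (h - 2 * m).
  by field; rewrite gt_eqF.
rewrite pmulr_rge0 ?subr_ge0 ?leNgt ?hm//.
by rewrite exprn_even_gt0 //= mulf_neq0 // invr_neq0 // gt_eqF.
Qed.

End CPCone.


(** * The Horn form on five cyclically ordered coordinates *)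

Section HornForm.
Context {R : realFieldType}.
Implicit Type x : 'I_5 -> R.

Definition lag (k : 'I_5) x := \sum_i x i * x (i + k).

Definition horn x := lag 0 x - 2 * lag 1 x + 2 * lag 2 x.

(** At a zero [(p, p + q, q, 0, 0)] of the Horn form this is [(p - q) ^ 2]. *)
Definition imbalance x := lag 1 x - 4 * lag 2 x.

Definition arc (i j : 'I_5) : R := [:: 1; 2; 1]`_(j - i)%R.

Definition edge (j : 'I_5) : R := [:: 1; 1]`_j.

Lemma arc_ge0 i j : 0 <= arc i j.
Proof. by rewrite /arc; case: (j - i)%R => -[|[|[|[|[|?]]]]]. Qed.

Lemma edge_ge0 j : 0 <= edge j.
Proof. by rewrite /edge; case: j => -[|[|[|[|[|?]]]]]. Qed.

Lemma sum5 (W : nmodType) (F : 'I_5 -> W) :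
  \sum_i F i = F 0 + (F 1 + (F 2 + (F 3 + F 4))).
Proof.
rewrite 5!big_ord_recl big_ord0 addr0.
by do ![congr (_ + _)]; congr F; apply/val_inj.
Qed.

Lemma lagE k x : lag k x = x 0 * x k + x 1 * x (1 + k) + x 2 * x (2 + k)
  + x 3 * x (3 + k) + x 4 * x (4 + k).
Proof. by rewrite /lag sum5 add0r !addrA. Qed.

Lemma ord5D :
  ((1 + 1 = 2 :> 'I_5)%R
  * (2 + 1 = 3 :> 'I_5)%R
  * (3 + 1 = 4 :> 'I_5)%R
  * (4 + 1 = 0 :> 'I_5)%R
  * (1 + 2 = 3 :> 'I_5)%R
  * (2 + 2 = 4 :> 'I_5)%R
  * (3 + 2 = 0 :> 'I_5)%R
  * (4 + 2 = 1 :> 'I_5)%R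
  * (1 + 0 = 1 :> 'I_5)%R
  * (2 + 0 = 2 :> 'I_5)%R
  * (3 + 0 = 3 :> 'I_5)%R
  * (4 + 0 = 4 :> 'I_5)%R)%type.
Proof. by do !split; apply/val_inj. Qed.

(** Invariance of [lag] under the dihedral symmetries of the pentagon cuts down
    the case analyses that follow. *)
Lemma lag_shift k i x : lag k (fun j => x (j - i)) = lag k x.
Proof.
rewrite /lag [RHS](reindex_inj (addIr (- i))) /=.
by apply: eq_bigr => j _; rewrite addrAC.
Qed.

Lemma horn_arc i : horn (arc i) = 0.
Proof.
rewrite /horn !(lag_shift _ _ (fun j : 'I_5 => [:: 1; 2; 1]`_j)) !lagE.
by rewrite !ord5D /=; ring.
Qed.

Lemma imbalance_arc i : imbalance (arc i) = 0.
Proof.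
rewrite /imbalance !(lag_shift _ _ (fun j : 'I_5 => [:: 1; 2; 1]`_j)) !lagE.
by rewrite !ord5D /=; ring.
Qed.

Lemma horn_edge : horn edge = 0.
Proof. by rewrite /horn !lagE !ord5D /edge /=; ring. Qed.

Lemma imbalance_edge : imbalance edge = 1.
Proof. by rewrite /imbalance !lagE !ord5D /edge /=; ring. Qed.

Lemma lag_reflect k x : lag k (fun j => x (2 - j)) = lag k x.
Proof.
rewrite /lag [RHS](reindex_inj (inj_comp (addIr (2 - k)) oppr_inj)) /=.
apply: eq_bigr => j _; rewrite mulrC; congr (x _ * x _); ring.
Qed.

(** When [x 3 <= x 4], the Horn form is a square plus two nonnegative products;
    the opposite case is its mirror image. At a zero all three summands vanish,
    which leaves the shifts of [(p, p + q, q, 0, 0)], where [imbalance] is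
    a square. *)
Lemma horn_imbalance_ge0 x : (forall i, 0 <= x i) ->
  0 <= horn x /\ (horn x = 0 -> 0 <= imbalance x).
Proof.
wlog le34 : x / x 3 <= x 4 => [WLOG|] x0.
  have [/WLOG|/ltW le43] := lerP (x 3) (x 4); first exact.
  have /= := WLOG (fun j => x (2 - j)).
  rewrite /horn /imbalance !lag_reflect.
  have -> : 2 - 3 = 4 :> 'I_5 by apply/val_inj.
  have -> : 2 - 4 = 3 :> 'I_5 by apply/val_inj.
  by apply.
pose s := x 0 - x 1 + x 2 + x 3 - x 4.
have hornE : horn x = s ^+ 2 + 4 * (x 1 * x 3) + 4 * (x 2 * (x 4 - x 3)).
  by rewrite /horn !lagE !ord5D /s; ring.
have s0 := sqr_ge0 s.
have p0 : 0 <= x 1 * x 3 by rewrite mulr_ge0.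
have q0 : 0 <= x 2 * (x 4 - x 3) by rewrite mulr_ge0 ?subr_ge0//.
rewrite hornE; split=> [|h0]; first lra.
have /eqP : x 1 * x 3 = 0 by lra.
have /eqP : x 2 * (x 4 - x 3) = 0 by lra.
have /eqP : s ^+ 2 = 0 by lra.
rewrite sqrf_eq0 !mulf_eq0 => /eqP; rewrite /s => {}s0 c2 c1.
have n0 := x0 0; have n1 := x0 1; have n2 := x0 2; have n3 := x0 3.
have n4 := x0 4.
rewrite /imbalance !lagE !ord5D.
move: c1 c2 => /orP[]/eqP c1 /orP[]/eqP c2.
- have -> : x 4 = x 0 + x 3 by lra.
  suff : 0 <= (x 0 - x 3) ^+ 2 by congr (0 <= _); rewrite c1 c2; ring.
  exact: sqr_ge0.
- have -> : x 4 = x 3 by lra.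
  have [-> ->] : x 0 = 0 /\ x 2 = 0 by lra.
  suff : 0 <= x 3 ^+ 2 by congr (0 <= _); rewrite c1; ring.
  exact: sqr_ge0.
- have -> : x 0 = x 1 + x 4 by lra.
  suff : 0 <= (x 1 - x 4) ^+ 2 by congr (0 <= _); rewrite c1 c2; ring.
  exact: sqr_ge0.
- have -> : x 4 = 0 by lra.
  have -> : x 1 = x 0 + x 2 by lra.
  suff : 0 <= (x 0 - x 2) ^+ 2 by congr (0 <= _); rewrite c1; ring.
  exact: sqr_ge0.
Qed.

(** The hypotheses say that [q] kills each [arc i] along its support. They
    force [q] to be a multiple of the Horn matrix; the conclusion is the
    vanishing of that matrix at [edge]. *)
Lemma horn_rigid (q : 'I_5 -> 'I_5 -> R) : (forall i j, q i j = q j i) ->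
  (forall i j, 1 <= arc i j -> q j i + 2 * q j (i + 1) + q j (i + 2) = 0) ->
  q 0 0 + 2 * q 0 1 + q 1 1 = 0.
Proof.
move=> qC q0.
have q0i i := And3 (q0 i i) (q0 i (i + 1)) (q0 i (i + 2)).
move: (q0i 0) (q0i 1) (q0i 2) (q0i 3) (q0i 4).
rewrite !(add0r, ord5D) /arc /=.
rewrite (qC 1 0) (qC 2 0) (qC 2 1) (qC 3 1) (qC 3 2) (qC 4 2) (qC 4 3).
rewrite (qC 3 0) (qC 4 0) (qC 4 1); have le12 : 1 <= 2 :> R by lra.
do 5 move=> [/(_ (lexx _)) ? /(_ le12) ? /(_ (lexx _)) ?].
lra.
Qed.

End HornForm.

(** * Positivity of idempotents in a Euclidean Jordan algebra *)

Section EuclideanJordanAlgebra.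
Context {R : realType} (E : euclideanJordanAlgebra R).
Variable ip : {dot E for idfun}.
Hypothesis ip_assoc : associative_ip (jmul E) ip.
Implicit Types x y z c : E.

Lemma jmulDl x y z : jmul E (x + y) z = jmul E x z + jmul E y z.
Proof. exact: linearDl. Qed.

Lemma jmulDr x y z : jmul E x (y + z) = jmul E x y + jmul E x z.
Proof. exact: linearDr. Qed.

Lemma jmulZl (a : R) x y : jmul E (a *: x) y = a *: jmul E x y.
Proof. exact: linearZl_LR. Qed.

Lemma jmulZr (a : R) x y : jmul E x (a *: y) = a *: jmul E x y.
Proof. exact: linearZr_LR. Qed.

Lemma dot_jmul c x y : ip (jmul E c x) y = ip x (jmul E c y).
Proof. by rewrite jmulC ip_assoc. Qed.

(** The Peirce identity [2 L^3 - 3 L^2 + L = 0], tested against [w]. It is the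
    term linear in [s] of the Jordan identity at [(c + s x, c)]; the values
    [s = 1], [-1], [2] separate it from the terms in [s ^ 2] and [s ^ 3].
    Pairing with [w] turns the elimination into real linear arithmetic. *)
Lemma peirce_cubic c x w : idempotent_elt c ->
  let L := jmul E c in
  2 * ip (L (L (L x))) w - 3 * ip (L (L x)) w + ip (L x) w = 0.
Proof.
move=> cc L.
have key s : let y := c + s *: x in
    ip (jmul E y (jmul E (jmul E y y) c)) w =
    ip (jmul E (jmul E y y) (jmul E y c)) w.
  by move=> y; rewrite jordan_identity.
have sq s : jmul E (c + s *: x) (c + s *: x) =
    c + (2 * s) *: L x + s ^+ 2 *: jmul E x x.
  rewrite jmulDl !jmulDr cc !(jmulZl, jmulZr) [jmul E x c]jmulC -/(L x).
  rewrite scalerA -expr2 addrA -[in LHS](addrA c) -scalerDl.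
  by congr (_ + _ *: _ + _); ring.
move: (key 1) (key (-1)) (key 2); rewrite /= !sq.
rewrite ![jmul E _ c]jmulC !(jmulDl, jmulDr, jmulZl, jmulZr) !cc -/L.
rewrite [jmul E x c]jmulC [jmul E (L x) c]jmulC [jmul E (jmul E x x) c]jmulC.
rewrite -/L !(dotDl, dotZl); lra.
Qed.

(** By the Peirce identity the spectrum of [L] lies in [{0, 1/2, 1}], so
    [L = (2 L^2 - L) ^ 2 + 8 (L - L^2) ^ 2]. *)
Lemma idempotent_dot_ge0 c x : idempotent_elt c -> 0 <= ip x (jmul E c x).
Proof.
move=> cc; have peirce := peirce_cubic x _ cc; move: peirce => /=.
set L := jmul E c => peirce.
have LA y z : ip (L y) z = ip y (L z) by exact: dot_jmul.
have := peirce x; have := peirce (L x).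
have := dot_ge0 ip (2 *: L (L x) + (-1) *: L x).
have := dot_ge0 ip (L x + (-1) *: L (L x)).
rewrite !(dotDl, dotDr, dotZl, dotZr) !LA; lra.
Qed.

Lemma cone_of_squares_dot_ge0 c x : idempotent_elt c -> cone_of_squares E x ->
  0 <= ip x c.
Proof.
move=> cc [y ->]; rewrite ip_assoc [jmul E y c]jmulC.
exact: idempotent_dot_ge0.
Qed.

Lemma cone_of_squares_cone : cone (cone_of_squares E).
Proof.
move=> a _ a0 [x ->]; exists (Num.sqrt a *: x).
by rewrite jmulZl jmulZr scalerA -expr2 sqr_sqrtr.
Qed.


(** * Coordinates along five orthogonal idempotents *)

Section OrthogonalIdempotents.
Variable e : 'I_5 -> E.
Hypothesis e_neq0 : forall i, e i != 0.
Hypothesis e_idem : forall i, idempotent_elt (e i).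
Hypothesis e_orth : forall i j, i != j -> jmul E (e i) (e j) = 0.

Definition comb (a : 'I_5 -> R) : E := \sum_i a i *: e i.

Definition dual_vec i : E := (ip (e i) (e i))^-1 *: e i.

Definition peirce_coord x i : R := ip x (dual_vec i).

Lemma comb_square a : (forall i, 0 <= a i) -> cone_of_squares E (comb a).
Proof.
move=> a0; exists (comb (fun i => Num.sqrt (a i))).
rewrite /comb linear_sumlz; apply: eq_bigr => i _.
rewrite linear_sumr (bigD1 i) //= big1 ?addr0 => [|j ji].
  by rewrite jmulZl jmulZr e_idem scalerA -expr2 sqr_sqrtr.
by rewrite jmulZl jmulZr e_orth 1?eq_sym// !scaler0.
Qed.

Lemma e_norm_gt0 i : 0 < ip (e i) (e i).
Proof. exact: neq0_dnorm_gt0. Qed.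

Lemma peirce_coord_comb a : peirce_coord (comb a) =1 a.
Proof.
move=> i; rewrite /peirce_coord dotZr dot_suml (bigD1 i) //= big1 ?addr0.
  by rewrite dotZl mulrC mulfK // gt_eqF ?e_norm_gt0.
by move=> j ji; rewrite dotZl -(e_idem i) -ip_assoc e_orth // linear0l mulr0.
Qed.

Lemma peirce_coord_ge0 x i : cone_of_squares E x -> 0 <= peirce_coord x i.
Proof.
move=> Kx; rewrite /peirce_coord dotZr mulr_ge0 //.
  by rewrite invr_ge0 ltW ?e_norm_gt0.
exact: cone_of_squares_dot_ge0.
Qed.

(** The linear functional on endomorphisms whose value at [tens x] is the
    quadratic form [lag k] of the coordinates of [x]. *)
Definition lag_form k (X : 'End(E)) : R :=
  \sum_i ip (X (dual_vec i)) (dual_vec (i + k)).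

Lemma lag_form_is_linear k : linear_for *%R (lag_form k).
Proof.
move=> a X Y; rewrite /lag_form mulr_sumr -big_split; apply: eq_bigr => i _ /=.
by rewrite add_lfunE scale_lfunE dotDl dotZl.
Qed.
HB.instance Definition _ k :=
  GRing.isLinear.Build R 'End(E) R *%R (lag_form k) (lag_form_is_linear k).

Lemma lag_form_tens k x : lag_form k (tens ip x) = lag k (peirce_coord x).
Proof. by apply: eq_bigr => i _; rewrite tensE dotZl. Qed.

Definition horn_form X := lag_form 0 X - 2 * lag_form 1 X + 2 * lag_form 2 X.
Definition imbalance_form X := lag_form 1 X - 4 * lag_form 2 X.

Lemma horn_form_is_linear : linear_for *%R horn_form.
Proof. by move=> a X Y; rewrite /horn_form !linearP /=; ring. Qed.
HB.instance Definition _ :=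
  GRing.isLinear.Build R 'End(E) R *%R horn_form horn_form_is_linear.

Lemma imbalance_form_is_linear : linear_for *%R imbalance_form.
Proof. by move=> a X Y; rewrite /imbalance_form !linearP /=; ring. Qed.
HB.instance Definition _ :=
  GRing.isLinear.Build R 'End(E) R *%R imbalance_form imbalance_form_is_linear.

Lemma horn_form_tens x : horn_form (tens ip x) = horn (peirce_coord x).
Proof. by rewrite /horn_form !lag_form_tens. Qed.

Lemma imbalance_form_tens x :
  imbalance_form (tens ip x) = imbalance (peirce_coord x).
Proof. by rewrite /imbalance_form !lag_form_tens. Qed.

(** The functional [horn_form] is nonnegative on the cone, so its zeros in the
    cone are sums of zeros. *)
Lemma imbalance_form_ge0 X : CP ip (cone_of_squares E) X -> horn_form X = 0 ->
  0 <= imbalance_form X.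
Proof.
move=> [k [x [_ xK ->]]]; rewrite !linear_sum /= => h0.
have hx i : 0 <= horn_form (tens ip (x i)) /\
    (horn_form (tens ip (x i)) = 0 -> 0 <= imbalance_form (tens ip (x i))).
  rewrite horn_form_tens imbalance_form_tens; apply: horn_imbalance_ge0 => j.
  exact: peirce_coord_ge0.
have hx0 i : 0 <= horn_form (tens ip (x i)) by case: (hx i).
apply: sumr_ge0 => i _; apply: (hx i).2.
exact: (psumr_eq0P (fun i _ => hx0 i) h0).
Qed.

Definition arc_sum : 'End(E) := \sum_i tens ip (comb (arc i)).
Definition edge_tens : 'End(E) := tens ip (comb edge).

Lemma arc_sum_CP : CP ip (cone_of_squares E) arc_sum.
Proof.
exists 5%N, (fun i => comb (arc i)); split=> // i; apply: comb_square => j.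
exact: arc_ge0.
Qed.

Lemma edge_tens_CP : CP ip (cone_of_squares E) edge_tens.
Proof. apply: CP_tens; apply: comb_square => j; exact: edge_ge0. Qed.

(** [horn_form] vanishes at the difference, whereas [imbalance_form] takes the
    value [- t] there. *)
Lemma arc_sum_sub_notin (t : R) : 0 < t ->
  ~ CP ip (cone_of_squares E) (arc_sum - t *: edge_tens).
Proof.
move=> t0 /imbalance_form_ge0.
have arc0 i : peirce_coord (comb (arc i)) = arc i.
  by apply/funext; exact: peirce_coord_comb.
have edge0 : peirce_coord (comb edge) = edge.
  by apply/funext; exact: peirce_coord_comb.
have horn0 : horn_form (arc_sum - t *: edge_tens) = 0.
  rewrite linearB linearZ linear_sum /= horn_form_tens edge0 horn_edge mulr0.
  by rewrite subr0 big1 // => i _; rewrite horn_form_tens arc0 horn_arc.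
have imbalanceN : imbalance_form (arc_sum - t *: edge_tens) = - t.
  rewrite linearB linearZ linear_sum /= imbalance_form_tens edge0.
  rewrite imbalance_edge mulr1 big1 ?sub0r // => i _.
  by rewrite imbalance_form_tens arc0 imbalance_arc.
by rewrite horn0 imbalanceN oppr_ge0 leNgt t0 => /(_ erefl).
Qed.

Lemma comb_arc i : comb (arc i) = e i + 2 *: e (i + 1) + e (i + 2).
Proof.
rewrite /comb (reindex_inj (addIr i)) /= sum5 /arc !addrK /=.
by rewrite !scale0r !addr0 !scale1r add0r ![_ + i]addrC addrA.
Qed.

Lemma comb_edge : comb edge = e 0 + e 1.
Proof. by rewrite /comb sum5 /edge /= !scale0r !addr0 !scale1r. Qed.

(** On the span of the [e i], the form [d] is copositive and vanishes at every
    [comb (arc i)]. Where [arc i] is at least [1], the coordinate can move by up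
    to [1] both ways, so the first-order condition gives the equations of
    [horn_rigid]. *)
Lemma dual_arc_edge d :
  dual_cone (selfadjoint ip) trace_ip (CP ip (cone_of_squares E)) d ->
  trace_ip arc_sum d = 0 -> trace_ip edge_tens d = 0.
Proof.
move=> [sd dd]; rewrite trace_ip_sum trace_ip_tens => A0.
have cd x : cone_of_squares E x -> 0 <= ip x (d x).
  by move=> Kx; rewrite -trace_ip_tens; apply: dd; exact: CP_tens.
have u0 i : ip (comb (arc i)) (d (comb (arc i))) = 0.
  rewrite -trace_ip_tens.
  apply: (psumr_eq0P (fun i _ => _) A0) => // {}i _; apply: dd; apply: CP_tens.
  by apply: comb_square => j; exact: arc_ge0.
pose q i j := ip (e i) (d (e j)).
have qC i j : q i j = q j i by rewrite /q -sd dotC.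
have := @horn_rigid R q qC.
have -> : ip (comb edge) (d (comb edge)) = q 0 0 + 2 * q 0 1 + q 1 1.
  have -> : d (comb edge) = d (e 0) + d (e 1) by rewrite comb_edge linearD.
  rewrite comb_edge !(dotDl, dotDr) -/(q 0 0) -/(q 0 1) -/(q 1 0).
  by rewrite -/(q 1 1) (qC 1 0); ring.
apply=> i j aij.
have := copositive_zero (v := e j) sd cd (u0 i).
have -> : d (comb (arc i)) = d (e i) + 2 *: d (e (i + 1)) + d (e (i + 2)).
  by rewrite comb_arc !linearD linearZ.
rewrite !dotDr dotZr; apply=> s s1.
have -> : comb (arc i) + s *: e j = comb (fun m => arc i m + s * (m == j)%:R).
  rewrite /comb [RHS](eq_bigr
    (fun m => arc i m *: e m + (s * (m == j)%:R) *: e m)).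
    rewrite big_split /=; congr (_ + _); rewrite (bigD1 j) //= eqxx mulr1.
    by rewrite big1 ?addr0 // => m /negPf ->; rewrite mulr0 scale0r.
  by move=> m _; rewrite scalerDl.
apply: comb_square => m; case: eqP => [->|_].
  by move: s1; rewrite ler_norml mulr1; lra.
by rewrite mulr0 addr0 arc_ge0.
Qed.

End OrthogonalIdempotents.
End EuclideanJordanAlgebra.

Theorem theorem6p1 (R : realType) (E : euclideanJordanAlgebra R)
    (ip : {dot E for idfun}%R) (ip_assoc : associative_ip (jmul E) ip)
    (rank_ge5 : (5 <= jordan_rank E)%N) :
  ~ facially_exposed (selfadjoint ip) trace_ip (CP ip (cone_of_squares E)).
Proof.
move=> exposed.
have [c [c_prim c_orth _]] : exists c : 'I_(jordan_rank E) -> E, jordan_frame c.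
  by move: rank_ge5; rewrite /jordan_rank; case: xgetP.
pose e (i : 'I_5) := c (widen_ord rank_ge5 i).
have e_neq0 i : e i != 0 by case: (c_prim (widen_ord rank_ge5 i)).
have e_idem i : idempotent_elt (e i).
  by case: (c_prim (widen_ord rank_ge5 i)).
have e_orth i j : i != j -> jmul E (e i) (e j) = 0 by move=> ij; apply: c_orth.
have CPc := CP_cone (ip := ip) (@cone_of_squares_cone R E).
have [t t0 Ct] := facially_exposed_sub CPc (@CP_add _ _ _ _) exposed
  (arc_sum_CP ip e_idem e_orth) (edge_tens_CP ip e_idem e_orth)
  (dual_arc_edge e_idem e_orth).
exact: (arc_sum_sub_notin ip_assoc e_neq0 e_idem e_orth t0 Ct).
Qed.
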